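(* Let $K\ge 2$, $d_1\ge 1$, $d_k=2^{k-1}d_1$ for $k=1,\dots,K$, and $\sigma>0$. Let $x$ be a random vector in $\mathbb{R}^{d_K}$ with $\mathbb{E}|x|^2<\infty$, and set $x^{(K)}=x$ and $x^{(k-1)}=D_k(x^{(k)})$ for $k=K,\dots,2$. Direct model: let $x_0\sim\mathcal N(0,\sigma^2 I_{d_K})$ be independent of $x$, and define $$L_A=\mathbb{E}\big[|x-x_0|^2\big]=\mathbb{E}|x|^2+\mathbb{E}|x_0|^2 .$$ Cascaded model: let $x_0^{(1)}\sim\mathcal N(0,\sigma^2 I_{d_1})$ be independent of $x$. For $2\le k\le K$ let $$x_0^{(k)}=U_k\big(D_k(x^{(k)})\big)+\sigma_k\zeta_k,\qquad \sigma_k=2^{-(k-1)}\sigma,$$ where $\zeta_k\sim\mathcal N(0,I_{d_k})$ is independent of $x$. Define $$L_k=\mathbb{E}\big[|x^{(k)}-x_0^{(k)}|^2\big]\quad (1\le k\le K),\qquad L_B=\sum_{k=1}^K L_k .$$ Then $L_A>L_B$.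
   Context: $|\cdot|$ is the Euclidean norm. For $2\le k\le K$, fix a partition of the coordinate index set $\{1,\dots,d_k\}$ into $d_{k-1}$ disjoint blocks of size $2$. - The downsampling operator $D_k:\mathbb{R}^{d_k}\to\mathbb{R}^{d_{k-1}}$ sends $y$ to the vector whose $j$-th entry is the average of the entries of $y$ in the $j$-th block (neighborhood averaging). - The upsampling operator $U_k:\mathbb{R}^{d_{k-1}}\to\mathbb{R}^{d_k}$ sends $w$ to the vector whose entries in the $j$-th block all equal $w_j$ (neighborhood replication). For the linear interpolant $I_t=(1-t)x_0+tx_1$, the transport cost is $L=\int_0^1\mathbb{E}|\dot I_t|^2\,dt=\mathbb{E}|x_1-x_0|^2$. Accordingly, $L_A$ is the transport cost of a single-stage flow from Gaussian noise to $x$, and $L_k$ is the transport cost of stage $k$ of a cascade in which stage $k$ maps $x_0^{(k)}$ to $x^{(k)}$. *)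

(* Defs.v *)
From HB Require Import structures.
From mathcomp Require Import all_boot all_order all_algebra.
From mathcomp Require Import all_classical all_reals all_analysis.
Set Implicit Arguments. Unset Strict Implicit. Unset Printing Implicit Defensive.
Import Order.TTheory GRing.Theory Num.Theory.
Local Open Scope classical_set_scope.
Local Open Scope ring_scope.

(* Vectors of R^n are represented as functions  nat -> R  of which only the
   coordinates 0 .. n-1 are used (all definitions below only read those). *)

Definition lvl_dim (d1 k : nat) : nat := (2 ^ k.-1 * d1)%N.

Definition sqnorm {R : realType} (n : nat) (y : nat -> R) : R :=
  \sum_(i < n) y i ^+ 2.

(* A partition of {0..d_k-1} into d_{k-1} blocks of size 2, given by the map
   [blk] sending a coordinate to the index of its block. *)
Definition is_pair_partition (n m : nat) (blk : nat -> nat) : Prop :=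
  (forall i, (i < n)%N -> (blk i < m)%N) /\
  (forall j, (j < m)%N -> #|[set i : 'I_n | blk i == j]| = 2%N).

Definition downs {R : realType} (n : nat) (blk : nat -> nat) (y : nat -> R)
  : nat -> R :=
  fun j => (\sum_(i < n | blk i == j) y i) / 2.

Definition ups {R : realType} (blk : nat -> nat) (w : nat -> R) : nat -> R :=
  fun i => w (blk i).

(* x^{(K-m)} obtained from x = x^{(K)} by m successive downsamplings:
   x^{(k-1)} = D_k x^{(k)}. *)
Fixpoint lev {R : realType} (d1 K : nat) (blk : nat -> nat -> nat)
  (x : nat -> R) (m : nat) : nat -> R :=
  match m with
  | O => x
  | S m' => downs (lvl_dim d1 (K - m')) (blk (K - m')%N) (lev d1 K blk x m')
  end.

Definition level {R : realType} (d1 K : nat) (blk : nat -> nat -> nat)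
  (x : nat -> R) (k : nat) : nat -> R := lev d1 K blk x (K - k).

Section Indep.
Context {d : measure_display} {T : measurableType d} {R : realType}.
Variable P : probability T R.

Definition indep_vec (n m : nat) (X : 'I_n -> T -> R) (Y : 'I_m -> T -> R)
  : Prop :=
  forall (A : 'I_n -> set R) (B : 'I_m -> set R),
    (forall i, measurable (A i)) -> (forall j, measurable (B j)) ->
    P ((\bigcap_i (X i @^-1` A i)) `&` (\bigcap_j (Y j @^-1` B j)))
    = (P (\bigcap_i (X i @^-1` A i)) * P (\bigcap_j (Y j @^-1` B j)))%E.

Definition mutual_indep (n : nat) (X : 'I_n -> T -> R) : Prop :=
  forall (A : 'I_n -> set R), (forall i, measurable (A i)) ->
    P (\bigcap_i (X i @^-1` A i)) = (\prod_i P (X i @^-1` A i))%E.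

(* X : T -> R^n (coordinates < n) is N(0, s^2 I_n)-distributed:
   i.i.d. coordinates with law N(0, s^2) (s = standard deviation). *)
Definition std_gaussian_vec (n : nat) (s : R) (X : T -> nat -> R) : Prop :=
  (forall i : 'I_n, measurable_fun setT (fun t => X t i)) /\
  mutual_indep (fun (i : 'I_n) t => X t i) /\
  (forall (i : 'I_n) (B : set R), measurable B ->
     P ((fun t => X t i) @^-1` B) = normal_prob 0 s B).
End Indep.

Definition coords {T R : Type} (n : nat) (X : T -> nat -> R) : 'I_n -> T -> R :=
  fun i t => X t i.
Arguments coords {T R} n X _ _.

(* Main.v *)
(* Independence and centering kill the cross terms, so each cost is a sum of
   second moments.  Since U_k D_k is an orthogonal projection and
   |U_k w|^2 = 2 |w|^2, stage k >= 2 costs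
   E|x^(k)|^2 - 2 E|x^(k-1)|^2 + d_k sigma_k^2, where
   d_k sigma_k^2 = 2^-(k-1) d_1 sigma^2.  The data terms sum to
   E|x|^2 - sum_(k < K) E|x^(k)|^2 <= E|x|^2, and the noise terms form a
   geometric series of sum < 2 d_1 sigma^2 <= d_K sigma^2.

   The value of the second moment c of N(0, 1) plays no role: it suffices that
   0 < c < oo and that N(0, s^2) has second moment s^2 c. *)
Require Import Defs.
From HB Require Import structures.
From mathcomp Require Import all_boot all_order all_algebra.
From mathcomp Require Import all_classical all_reals all_analysis.
From mathcomp Require Import measurable_realfun ring lra.
Import Order.TTheory GRing.Theory Num.Theory numFieldNormedType.Exports.
Local Open Scope classical_set_scope.
Local Open Scope ring_scope.

(** * Second moments of centred normal laws *)

Section NormalMoments.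
Context {R : realType}.
Local Notation mu := (@lebesgue_measure R).

(** The Radon-Nikodym derivative of [normal_prob m s] and [normal_pdf m s] have the same integral
    over every measurable set, so they agree almost everywhere and can be exchanged under the
    integral. *)
Lemma ge0_integral_normal_prob (m s : R) (f : R -> \bar R) :
  measurable_fun setT f -> (forall x, 0 <= f x)%E ->
  (\int[normal_prob m s]_x f x = \int[mu]_x (f x * (normal_pdf m s x)%:E))%E.
Proof.
move=> mf f0.
have dom := normal_prob_dominates m s.
rewrite -(Radon_Nikodym_SigmaFinite.change_of_variables dom f0 measurableT mf).
have iRN := Radon_Nikodym_SigmaFinite.f_integrable dom.
have mpdf : measurable_fun setT (fun x : R => (normal_pdf m s x)%:E).
  by apply/measurable_EFinP; exact: measurable_normal_pdf.
apply: ae_eq_integral => //.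
- by apply: emeasurable_funM => //; exact: measurable_int iRN.
- exact: emeasurable_funM.
apply: ae_eqe_mul2l; apply: integral_ae_eq => // A _ mA.
by rewrite -Radon_Nikodym_SigmaFinite.f_integral.
Qed.

(* s != 0 is needed: [normal_prob m 0] is the uniform law on [0, 1]. *)
Lemma normal_prob_preimage_opp (s : R) (B : set R) : s != 0 -> measurable B ->
  normal_prob 0 s (-%R @^-1` B) = normal_prob 0 s B.
Proof.
move=> s0 mB; rewrite /normal_prob.
(* Lebesgue measure is invariant under negation, and the centred density is even. *)
transitivity (\int[pushforward mu (-%R : _ -> measurableTypeR R)]_(x in B)
    (normal_pdf 0 s x)%:E)%E; last first.
  by apply: eq_measure_integral => A mA _; exact: lebesgue_measureN.
rewrite ge0_integral_pushforward//.
- apply: eq_integral => x _ /=; congr EFin.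
  by rewrite !normal_pdfE// /normal_fun !subr0 sqrrN.
- apply/measurable_EFinP/measurable_funTS; exact: measurable_normal_pdf.
- by move=> x _; rewrite lee_fin normal_pdf_ge0.
Qed.

Definition normal_moment2 (s : R) : \bar R :=
  (\int[normal_prob 0 s]_x (x ^+ 2)%:E)%E.

Lemma normal_peakZ (s : R) : 0 < s -> normal_peak s * s = normal_peak 1.
Proof.
move=> s0; rewrite /normal_peak expr1n mul1r -mulrnAr sqrtrM ?sqr_ge0//.
by rewrite sqrtr_sqr gtr0_norm// invfM mulrAC mulVf ?mul1r// gt_eqF.
Qed.

Lemma normal_funZ (s x : R) : s != 0 ->
  normal_fun 0 s (s * x) = normal_fun 0 1 x.
Proof.
by move=> s0; rewrite /normal_fun !subr0; congr expR; field.
Qed.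

Lemma normal_moment2E (s : R) : s != 0 -> normal_moment2 s =
  (\int[mu]_x (x ^+ 2 * (normal_peak s * normal_fun 0 s x))%:E)%E.
Proof.
move=> s0; rewrite /normal_moment2 ge0_integral_normal_prob//.
- by rewrite normal_pdfE//; under eq_integral do rewrite -EFinM.
- by apply/measurable_EFinP; exact: measurable_funX.
- by move=> x; rewrite lee_fin sqr_ge0.
Qed.

(** Substitution of s x for x: the square yields s^2, and the density times the Jacobian [s] becomes
    the density of N(0, 1). *)
Lemma normal_moment2Z (s : R) : 0 < s ->
  normal_moment2 s = ((s ^+ 2)%:E * normal_moment2 1)%E.
Proof.
move=> s0; have sn0 : s != 0 by rewrite gt_eqF.
pose G x : R := x ^+ 2 * (normal_peak s * normal_fun 0 s x).
have G0 x : 0 <= G x.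
  by rewrite mulr_ge0 ?sqr_ge0// mulr_ge0 ?normal_peak_ge0 ?normal_fun_ge0.
have cG : continuous G.
  move=> x; apply: cvgM; first exact: exprn_continuous.
  by have := @continuous_normal_pdf R 0 s sn0 x; rewrite normal_pdfE.
rewrite normal_moment2E// normal_moment2E ?oner_eq0//.
have dF : (fun x : R => s * x)^`()%classic = cst s.
  apply/funext => x; rewrite derive1E deriveM// derive_cst derive_id scaler0.
  by rewrite addr0 /GRing.scale/= mulr1.
rewrite (@increasing_ge0_integration_by_substitutionT _ (fun x => s * x) G)//.
- rewrite dF -ge0_integralZl//.
  + apply: eq_integral => x _; rewrite -EFinM; congr EFin.
    by rewrite !fctE /G normal_funZ// -(normal_peakZ s s0); ring.
  + apply/measurable_EFinP/measurable_funM; first exact: measurable_funX.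
    by apply: measurable_funM => //; exact: measurable_normal_fun.
  + by move=> x _; rewrite lee_fin mulr_ge0 ?sqr_ge0// mulr_ge0 ?normal_peak_ge0
      ?normal_fun_ge0.
  + by rewrite lee_fin sqr_ge0.
- by move=> x y xy; rewrite ltr_pM2l.
- by rewrite dF; exact: cst_continuous.
- by rewrite dF; exact: is_cvg_cst.
- by rewrite dF; exact: is_cvg_cst.
- exact/gt0_cvgMrNy.
- exact/gt0_cvgMry.
Qed.

(* From y <= exp y at y = x^2 / 4. *)
Lemma sqr_normal_fun_le (x : R) :
  x ^+ 2 * normal_fun 0 1 x <= 4 * normal_fun 0 (Num.sqrt 2) x.
Proof.
rewrite /normal_fun !subr0 sqr_sqrtr//.
(* The exponent splits into two halves: one gives the profile of variance 2, the other absorbs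
   x^2. *)
rewrite (_ : - x ^+ 2 / (1 ^+ 2 *+ 2) = - x ^+ 2 / (2 *+ 2) - x ^+ 2 / (2 *+ 2)).
  rewrite expRD mulrCA mulrC ler_wpM2r ?expR_ge0// expRN.
  rewrite ler_pdivrMr ?expR_gt0//.
  have := expR_ge1Dx (x ^+ 2 / (2 *+ 2)); lra.
by field.
Qed.

Lemma normal_moment2_fin_num : normal_moment2 1 \is a fin_num.
Proof.
have s0 : Num.sqrt (2 : R) != 0 by rewrite gt_eqF// sqrtr_gt0.
have peak0 := normal_peak_gt0 s0.
(* With this [K], the pointwise bound above becomes domination by [K] times the density of N(0,
   2). *)
pose K : R := 4 * normal_peak 1 / normal_peak (Num.sqrt 2).
have iK : mu.-integrable setT (fun x => (K%:E * (normal_pdf 0 (Num.sqrt 2) x)%:E)%E).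
  by apply: integrableZl => //; exact: integrable_normal_pdf.
rewrite normal_moment2E ?oner_eq0//.
have i1 : mu.-integrable setT (fun x => (x ^+ 2 * (normal_peak 1 * normal_fun 0 1 x))%:E).
  apply: le_integrable iK => //.
    apply/measurable_EFinP/measurable_funM; first exact: measurable_funX.
    by apply: measurable_funM => //; exact: measurable_normal_fun.
  move=> x _; rewrite -EFinM !abse_EFin lee_fin normal_pdfE//.
  rewrite !ger0_norm.
  - rewrite mulrCA [leRHS](_ : _ = normal_peak 1 * (4 * normal_fun 0 (Num.sqrt 2) x)).
      by rewrite ler_wpM2l ?normal_peak_ge0 ?sqr_normal_fun_le.
    by rewrite /K; field; rewrite gt_eqF.
  - by rewrite /K !mulr_ge0 ?invr_ge0 ?normal_peak_ge0 ?normal_fun_ge0.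
  - by rewrite mulr_ge0 ?sqr_ge0// mulr_ge0 ?normal_peak_ge0 ?normal_fun_ge0.
exact: integrable_fin_num i1.
Qed.

(* Otherwise the law would be concentrated at 0, a Lebesgue-null set. *)
Lemma normal_moment2_gt0 : (0 < normal_moment2 1)%E.
Proof.
rewrite lt_neqAle integral_ge0 ?andbT; last by move=> x _; rewrite lee_fin sqr_ge0.
apply/negP => /eqP/esym m0.
have : ae_eq (normal_prob 0 1) setT (fun x : R => (x ^+ 2)%:E) (cst 0%E).
  apply/(ae_eq_integral_abs _ measurableT).
    by apply/measurable_EFinP; exact: measurable_funX.
  rewrite -[RHS]m0; apply: eq_integral => x _.
  by rewrite abse_EFin ger0_norm ?sqr_ge0.
case=> N [mN N0 sub].
have zero0 : normal_prob 0 1 [set (0 : R)] = 0%E.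
  have /null_content_dominatesP := normal_prob_dominates (0 : R) 1.
  by apply => //; exact: lebesgue_measure_set1.
(* Since x^2 vanishes outside [N], this null union is the whole line, which has mass 1. *)
have : normal_prob (0 : R) 1 (N `|` [set 0]) = 0%E.
  by apply: null_set_setU.
rewrite (_ : N `|` [set 0] = setT); last first.
  apply/seteqP; split=> // x _; have [->|x0] := eqVneq x 0; [by right|left].
  apply: sub => /= /(_ I)/eqP; rewrite eqe sqrf_eq0; exact/negP.
by rewrite probability_setT => /eqP; rewrite onee_eq0.
Qed.
End NormalMoments.

(** * Square-integrable variables and symmetric noise *)

Section L2.
Context {d : measure_display} {T : measurableType d} {R : realType}.
Variable P : probability T R.

Lemma Lfun2P (f : T -> R) : measurable_fun setT f ->
  P.-integrable setT (fun t => (f t ^+ 2)%:E) -> f \in Lfun P 2%:E.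
Proof.
move=> mf /integrableP[_ ifin].
rewrite inE; apply/andP; split; rewrite inE//= /finite_norm unlock /Lnorm.
rewrite poweR_lty//; apply: le_lt_trans ifin.
apply: ge0_le_integral => //.
- by move=> t _; rewrite poweR_ge0.
- apply/measurable_EFinP.
  apply: (@measurableT_comp _ _ _ _ _ _ (fun x : R => x `^ 2)) => //.
  exact: measurableT_comp.
- by apply: measurableT_comp => //; apply/measurable_EFinP; exact: measurable_funX.
- by move=> t _; rewrite /= lee_fin powR_mulrn// normrX.
Qed.

(* (X, Z) and (X, - Z) have the same law, hence E[XZ] = - E[XZ]. *)
Lemma expectation_mul_sym (X Z : {mfun T >-> R}) :
  (X : T -> R) \in Lfun P 2%:E -> (Z : T -> R) \in Lfun P 2%:E ->
  (forall A B : set R, measurable A -> measurable B ->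
     P (X @^-1` A `&` Z @^-1` B) = (P (X @^-1` A) * P (Z @^-1` B))%E) ->
  (forall B : set R, measurable B -> P (Z @^-1` (-%R @^-1` B)) = P (Z @^-1` B)) ->
  ('E_P[X \* Z] = 0)%E.
Proof.
move=> X2 Z2 indep sym.
have XZ1 := Lfun2_mul_Lfun1 X2 Z2.
have mXZ : measurable_fun setT (fun t => (X t, Z t)) by exact: measurable_fun_pair.
have mXNZ : measurable_fun setT (fun t => (X t, - Z t)).
  by apply: measurable_fun_pair => //; exact: measurableT_comp.
pose XZ : {mfun T >-> (R * R)%type} := HB.pack (fun t => (X t, Z t))
  (isMeasurableFun.Build _ _ _ _ _ mXZ).
pose XNZ : {mfun T >-> (R * R)%type} := HB.pack (fun t => (X t, - Z t))
  (isMeasurableFun.Build _ _ _ _ _ mXNZ).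
(* By independence and symmetry, both joint laws agree on rectangles with the product of the laws of
   [X] and [Z], hence both are the product measure. *)
have lawE (A : set (R * R)) : measurable A ->
    distribution P XZ A = distribution P XNZ A.
  move=> mA.
  transitivity ((distribution P X \x distribution P Z)%E A).
    by apply/esym; apply: product_measure_unique.
  apply: (@product_measure_unique _ _ _ _ _ (distribution P X) (distribution P Z)
    (distribution P XNZ)) => //.
  move=> B C mB mC.
  rewrite /= /distribution /pushforward/= -(sym C)//.
  rewrite -indep// -[X in measurable X]setTI.
  exact: oppr_measurable.
have mf : measurable_fun setT (fun z : R * R => (z.1 * z.2)%:E).
  by apply/measurable_EFinP; exact: measurable_funM.
have E1 : ('E_P[X \* Z] = \int[distribution P XZ]_z (z.1 * z.2)%:E)%E.
  rewrite unlock integral_distribution//=.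
  exact/Lfun1_integrable.
have E2 : ('E_P[(\- (X \* Z))%R] = \int[distribution P XNZ]_z (z.1 * z.2)%:E)%E.
  rewrite unlock integral_distribution//=.
    by apply: eq_integral => t _; rewrite mulrN.
  rewrite (_ : _ \o _ = EFin \o (\- (X \* Z))); last first.
    by apply/funext => t /=; rewrite mulrN.
  by apply/Lfun1_integrable; rewrite rpredN.
have : ('E_P[X \* Z] = - 'E_P[X \* Z])%E.
  rewrite [LHS]E1 (eq_measure_integral (distribution P XNZ)); last first.
    by move=> A mA _; exact: lawE.
  rewrite -E2 unlock -integralN; first by [].
  by have /Lfun1_integrable iXZ := XZ1; exact: integrable_add_def.
have /fineK <- := expectation_fin_num XZ1.
by rewrite -EFinN => -[] h; congr EFin; lra.
Qed.

(** * Orthogonality to a noise variable *)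

(** Replaces independence: it suffices to kill the cross terms, and it is stable under linear
    combinations, so it passes from the coordinates of [x] to all downsampled levels. *)
Definition L2orth (Z f : T -> R) : Prop :=
  f \in Lfun P 2%:E /\ ('E_P[f \* Z] = 0)%E.

Lemma L2orth_linear (Z f g : T -> R) (a : R) : Z \in Lfun P 2%:E ->
  L2orth Z f -> L2orth Z g -> L2orth Z (fun t => a * f t + g t).
Proof.
move=> Z2 [f2 fZ] [g2 gZ].
have af2 : a \o* f \in Lfun P 2%:E by apply: Lfun_scale => //; rewrite ler1n.
have fZ1 := Lfun2_mul_Lfun1 f2 Z2.
have gZ1 := Lfun2_mul_Lfun1 g2 Z2.
have afZ1 : a \o* (f \* Z) \in Lfun P 1 by exact: Lfun_scale.
split.
  rewrite (_ : (fun _ => _) = (a \o* f) \+ g); first by rewrite rpredD ?lee1n.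
  by apply/funext => t /=; rewrite mulrC.
rewrite (_ : _ \* _ = (a \o* (f \* Z)) \+ (g \* Z)).
  by rewrite expectationD// expectationZl// fZ gZ mule0 adde0.
by apply/funext => t /=; ring.
Qed.

Lemma L2orth0 (Z : T -> R) : L2orth Z (fun=> 0).
Proof.
split; first by rewrite (_ : (fun=> 0) = cst 0)// Lfun_cst.
rewrite (_ : _ \* _ = cst 0) ?expectation_cst//.
by apply/funext => t /=; rewrite mul0r.
Qed.

Lemma L2orth_sum (Z : T -> R) n (p : pred 'I_n) (f : 'I_n -> T -> R) :
  Z \in Lfun P 2%:E -> (forall i, L2orth Z (f i)) ->
  L2orth Z (fun t => \sum_(i < n | p i) f i t).
Proof.
move=> Z2 fZ.
(* The sum becomes an iterated operation on functions, so that induction on it applies to a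
   predicate on functions. *)
have -> : (fun t => \sum_(i < n | p i) f i t)
    = \big[(fun u v t => u t + v t)/(fun=> 0)]_(i < n | p i) f i.
  apply/funext => t.
  by apply: (big_ind2 (fun a u => a = u t)) => // a1 u1 a2 u2 -> ->.
apply: big_ind => //; first exact: L2orth0.
move=> u v uZ vZ; have := L2orth_linear _ _ _ 1 Z2 uZ vZ.
by under eq_fun do rewrite mul1r.
Qed.

Lemma L2orth_downs (Z : T -> R) n blk (y : T -> nat -> R) j :
  Z \in Lfun P 2%:E -> (forall i, (i < n)%N -> L2orth Z (y ^~ i)) ->
  L2orth Z (fun t => downs n blk (y t) j).
Proof.
move=> Z2 yZ; rewrite /downs.
have yZ' (i : 'I_n) : L2orth Z (fun t => y t i) by exact: yZ.
have := L2orth_linear _ _ _ 2^-1 Z2 (L2orth_sum _ _ (fun i : 'I_n => blk i == j) _ Z2 yZ')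
  (L2orth0 Z).
by under eq_fun do rewrite addr0 mulrC.
Qed.

(** Induction on the number K - k of downsamplings, each of which is linear. *)
Lemma L2orth_level (Z : T -> R) d1 K blk (x : T -> nat -> R) k i :
  Z \in Lfun P 2%:E ->
  (forall i, (i < lvl_dim d1 K)%N -> L2orth Z (x ^~ i)) ->
  (k <= K)%N -> (i < lvl_dim d1 k)%N ->
  L2orth Z (fun t => level d1 K blk (x t) k i).
Proof.
move=> Z2 xZ kK; rewrite -{1}(subKn kK) /level.
elim: (K - k)%N i => [|m IH] i; first by rewrite subn0; exact: xZ.
by move=> _ /=; exact: L2orth_downs.
Qed.

(** * Expected squared norms *)

Definition L2vec n (f : T -> nat -> R) : Prop :=
  forall i, (i < n)%N -> (f ^~ i) \in Lfun P 2%:E.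

Lemma sqnorm_Lfun1 n (f : T -> nat -> R) : L2vec n f ->
  (fun t => sqnorm n (f t)) \in Lfun P 1.
Proof.
move=> f2; apply/Lfun1_integrable.
rewrite (_ : _ \o _ = fun t => \sum_(i < n) (f t i ^+ 2)%:E)%E.
  apply: integrable_sum => // i _.
  exact: (Lfun2_integrable_sqr (f2 _ (ltn_ord i))).
by apply/funext => t /=; rewrite sumEFin.
Qed.

Lemma expectation_sqnorm n (f : T -> nat -> R) : L2vec n f ->
  ('E_P[(fun t => sqnorm n (f t))] = \sum_(i < n) 'E_P[(fun t => (f t i) ^+ 2)%R])%E.
Proof.
move=> f2; rewrite unlock -integral_sum//.
  by apply: eq_integral => t _; rewrite sumEFin.
by move=> i; exact: (Lfun2_integrable_sqr (f2 _ (ltn_ord i))).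
Qed.

Lemma expectation_sqr_noise (f Z : T -> R) (a : R) :
  Z \in Lfun P 2%:E -> L2orth Z f ->
  ('E_P[(fun t => (f t - a * Z t) ^+ 2)%R] =
   'E_P[(fun t => f t ^+ 2)%R] + (a ^+ 2)%:E * 'E_P[(fun t => Z t ^+ 2)%R])%E.
Proof.
move=> Z2 [f2 fZ].
have fZ1 := Lfun2_mul_Lfun1 f2 Z2.
have ff1 := Lfun2_mul_Lfun1 f2 f2.
have ZZ1 := Lfun2_mul_Lfun1 Z2 Z2.
have h1 : (- (2 * a)) \o* (f \* Z) \in Lfun P 1 by exact: Lfun_scale.
have h2 : (a ^+ 2) \o* (Z \* Z) \in Lfun P 1 by exact: Lfun_scale.
rewrite (_ : (fun t => (f t - a * Z t) ^+ 2) =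
  ((f \* f) \+ (- (2 * a)) \o* (f \* Z)) \+ (a ^+ 2) \o* (Z \* Z)).
  rewrite expectationD//= ?rpredD// expectationD// !expectationZl// fZ mule0 adde0.
  by [].
by apply/funext => t /=; ring.
Qed.

(** Common to all the costs: a = 1 for the direct model and the first stage, a = sigma_k for the
    later stages. *)
Lemma expectation_sqnorm_noise n (f Z : T -> nat -> R) (a v : R) :
  (forall i, (i < n)%N -> [/\ Z ^~ i \in Lfun P 2%:E, L2orth (Z ^~ i) (f ^~ i) &
    ('E_P[(fun t => Z t i ^+ 2)%R] = v%:E)%E]) ->
  ('E_P[(fun t => sqnorm n (fun i => f t i - a * Z t i)%R)] =
   'E_P[(fun t => sqnorm n (f t))] + (n%:R * (a ^+ 2 * v))%:E)%E.
Proof.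
move=> H; rewrite !expectation_sqnorm//.
- rewrite (eq_bigr (fun i : 'I_n => 'E_P[(fun t => f t i ^+ 2)%R] + (a ^+ 2 * v)%:E)%E).
    by rewrite big_split/= sumEFin sumr_const card_ord mulr_natl.
  move=> i _; have [Z2 fZ Zv] := H _ (ltn_ord i).
  by rewrite expectation_sqr_noise// Zv EFinM.
- by move=> i /H[_ []].
- move=> i /H[Z2 [f2 _] _].
  rewrite [X in X \in _](_ : _ = (f ^~ i) \+ (- a) \o* (Z ^~ i)).
    rewrite rpredD ?lee1n//= => _.
    by apply: Lfun_scale; rewrite ?ler1n.
  by apply/funext => t /=; ring.
Qed.

(** * Geometry of the block projection *)

(** On a block of two entries with mean w, the sum of (y_i - w)^2 is the sum of y_i^2 minus 2 w (2
    w) plus 2 w^2, that is, minus 2 w^2 in total. Summing over the blocks gives Pythagoras for the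
    projection. *)
Lemma sqnorm_sub_ups_downs n m blk (y : nat -> R) :
  is_pair_partition n m blk ->
  sqnorm n (fun i => y i - ups blk (downs n blk y) i) =
  sqnorm n y - 2 * sqnorm m (downs n blk y).
Proof.
move=> [blkm card2].
pose w := downs n blk y.
have split_sum (F : 'I_n -> R) :
    \sum_(i < n) F i = \sum_(j < m) \sum_(i < n | blk i == j) F i.
  rewrite (exchange_big_dep xpredT)//=; apply: eq_bigr => i _.
  by rewrite (big_pred1 (Ordinal (blkm i (ltn_ord i)))).
rewrite /sqnorm mulr_sumr !split_sum -sumrB; apply: eq_bigr => j _.
have -> : \sum_(i < n | blk i == j) (y i - ups blk w i) ^+ 2 =
    \sum_(i < n | blk i == j) (y i ^+ 2 - 2 * w j * y i + w j ^+ 2).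
  by apply: eq_bigr => i /eqP <-; rewrite /ups; ring.
rewrite big_split/= sumrB -mulr_sumr.
have -> : \sum_(i < n | blk i == j) y i = 2 * w j.
  by rewrite /w /downs mulrC divfK// pnatr_eq0.
rewrite sumr_const.
have -> : #|[pred i : 'I_n | blk i == j]| = 2%N.
  rewrite -(card2 _ (ltn_ord j)); apply: eq_card => i; rewrite !inE.
  by apply/idP/idP; rewrite inE.
by rewrite -/w; ring.
Qed.

Lemma expectation_sqnorm_sub_ups_downs n m blk (f : T -> nat -> R) :
  is_pair_partition n m blk -> L2vec n f ->
  L2vec m (fun t => downs n blk (f t)) ->
  ('E_P[(fun t => sqnorm n (fun i => f t i - ups blk (downs n blk (f t)) i)%R)] =
   'E_P[(fun t => sqnorm n (f t))]
   - 2%:E * 'E_P[(fun t => sqnorm m (downs n blk (f t)))])%E.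
Proof.
move=> part f2 Df2.
under [in LHS]eq_fun do rewrite (sqnorm_sub_ups_downs _ _ _ _ part).
have h1 := sqnorm_Lfun1 _ _ f2.
have h2 := sqnorm_Lfun1 _ _ Df2.
rewrite -expectationZl// -expectationB//; last exact: Lfun_scale.
by congr expectation; apply/funext => t /=; rewrite (mulrC _ 2).
Qed.

(** * Gaussian noise independent of the data *)

Lemma gaussian_moment2 (Z : T -> R) (s : R) : 0 < s -> measurable_fun setT Z ->
  (forall B : set R, measurable B -> P (Z @^-1` B) = normal_prob 0 s B) ->
  Z \in Lfun P 2%:E /\
  ('E_P[(fun t => Z t ^+ 2)%R] = (s ^+ 2 * fine (@normal_moment2 R 1))%:E)%E.
Proof.
move=> s0 mZ law.
pose Z' : {mfun T >-> measurableTypeR R} := HB.pack (Z : T -> measurableTypeR R)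
  (isMeasurableFun.Build _ _ T (measurableTypeR R) Z mZ).
have E : (\int[P]_t (Z t ^+ 2)%:E = (s ^+ 2 * fine (@normal_moment2 R 1))%:E)%E.
  rewrite EFinM fineK ?normal_moment2_fin_num// -normal_moment2Z//.
  rewrite -(@ge0_integral_distribution _ _ _ _ _ P Z'
    (fun x : measurableTypeR R => ((x : R) ^+ 2)%:E)).
  - by apply: eq_measure_integral => A mA _; exact: law.
  - by apply/measurable_EFinP; exact: measurable_funX.
  - by move=> x; rewrite lee_fin sqr_ge0.
split; last by rewrite unlock.
apply: Lfun2P => //; apply/integrableP; split.
  by apply/measurable_EFinP; exact: measurable_funX.
under eq_integral do rewrite abse_EFin ger0_norm ?sqr_ge0//.
by rewrite E ltry.
Qed.

(* Cylinders: take [setT] in all the other coordinates. *)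
Lemma indep_vec_pair n m (X : 'I_n -> T -> R) (Y : 'I_m -> T -> R) i j
    (A B : set R) : indep_vec P X Y -> measurable A -> measurable B ->
  P (X i @^-1` A `&` Y j @^-1` B) = (P (X i @^-1` A) * P (Y j @^-1` B))%E.
Proof.
have cylE k (V : 'I_k -> T -> R) l (C : set R) :
    \bigcap_l' (V l' @^-1` (if l' == l then C else setT)) = V l @^-1` C.
  apply/seteqP; split=> [t /(_ l I)|t Ct l' _]; first by rewrite /= eqxx.
  by rewrite /=; case: eqP => // ->.
move=> indep mA mB.
have := indep (fun i' => if i' == i then A else setT)
              (fun j' => if j' == j then B else setT).
by rewrite !cylE; apply=> k; case: ifP.
Qed.

(** Combines the product formula for one coordinate of each vector with the symmetry of the centred
    normal law. *)
Lemma gaussian_L2orth n m (s : R) (x Z : T -> nat -> R) i j : 0 < s ->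
  (i < n)%N -> (j < m)%N ->
  x ^~ i \in Lfun P 2%:E -> measurable_fun setT (x ^~ i) ->
  std_gaussian_vec P m s Z -> indep_vec P (coords n x) (coords m Z) ->
  L2orth (Z ^~ j) (x ^~ i).
Proof.
move=> s0 ltin ltjm x2 mx [mZ [_ law]] indep; split=> //.
have mZj := mZ (Ordinal ltjm).
have [Z2 _] := gaussian_moment2 _ _ s0 mZj (law (Ordinal ltjm)).
pose X' : {mfun T >-> R} := HB.pack (x ^~ i) (isMeasurableFun.Build _ _ _ _ _ mx).
pose Z' : {mfun T >-> R} := HB.pack (Z ^~ j) (isMeasurableFun.Build _ _ _ _ _ mZj).
apply: (expectation_mul_sym X' Z') => //.
  move=> A B mA mB.
  exact: (indep_vec_pair _ _ _ _ (Ordinal ltin) (Ordinal ltjm) A B indep mA mB).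
move=> B mB; rewrite (law (Ordinal ltjm)); last first.
  by rewrite -[X in measurable X]setTI; exact: oppr_measurable.
by rewrite normal_prob_preimage_opp ?gt_eqF// -(law (Ordinal ltjm)).
Qed.
End L2.

(** * Summation of the stage costs *)

(** Here [e k] stands for E|x^(k)|^2. Adding stage n + 2 to the bound leaves e (n + 2) - e (n + 1),
    whose negative term is dropped; the noise terms add up to w (1 + 1/2 + ... + 1/2^n). *)
Lemma telescoped_cost_le {R : realType} (e L : nat -> R) (w : R) n :
  (forall k, 0 <= e k) -> L 1%N = e 1%N + w ->
  (forall k, (2 <= k <= n.+1)%N -> L k = e k - 2 * e k.-1 + w / 2 ^+ k.-1) ->
  \sum_(1 <= k < n.+2) L k <= e n.+1 + w * (2 - 1 / 2 ^+ n).
Proof.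
move=> e0 L1; elim: n => [|n IH] Lk.
  by rewrite big_nat1 L1 expr0; lra.
rewrite big_nat_recr//= (Lk n.+2) ?leqnn// exprS /=.
have {}IH : \sum_(1 <= k < n.+2) L k <= e n.+1 + w * (2 - 1 / 2 ^+ n).
  by apply: IH => k /andP[k2 kn]; apply/Lk/andP; split=> //; exact: leqW.
have := e0 n.+1; rewrite !div1r in IH *; rewrite invfM.
by set r := (2 ^+ n)^-1 in IH *; lra.
Qed.

Lemma level_pred {R : realType} d1 K blk (y : nat -> R) k : (0 < k <= K)%N ->
  level d1 K blk y k.-1 = downs (lvl_dim d1 k) (blk k) (level d1 K blk y k).
Proof.
case: k => // k /= kK; rewrite /level -subnSK//=.
by rewrite subKn.
Qed.

(** * Comparison of the two models *)

Theorem theorem1 (R : realType) (d : measure_display) (T : measurableType d)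
  (P : probability T R) (K d1 : nat) (sigma : R)
  (blk : nat -> nat -> nat)
  (x x0 x01 : T -> nat -> R) (zeta : nat -> T -> nat -> R) :
  (2 <= K)%N -> (1 <= d1)%N -> 0 < sigma ->
  (* for 2 <= k <= K, a partition of the d_k coordinates into d_{k-1} pairs *)
  (forall k, (2 <= k <= K)%N ->
     is_pair_partition (lvl_dim d1 k) (lvl_dim d1 k.-1) (blk k)) ->
  (* x is a random vector in R^{d_K} with E|x|^2 < oo *)
  (forall i : 'I_(lvl_dim d1 K), measurable_fun setT (fun t => x t i)) ->
  (forall i : 'I_(lvl_dim d1 K), P.-integrable setT (fun t => (x t i ^+ 2)%:E)) ->
  (* direct model: x0 ~ N(0, sigma^2 I_{d_K}) independent of x *)
  std_gaussian_vec P (lvl_dim d1 K) sigma x0 ->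
  indep_vec P (coords (lvl_dim d1 K) x) (coords (lvl_dim d1 K) x0) ->
  (* cascaded model: x0^(1) ~ N(0, sigma^2 I_{d_1}) independent of x *)
  std_gaussian_vec P (lvl_dim d1 1) sigma x01 ->
  indep_vec P (coords (lvl_dim d1 K) x) (coords (lvl_dim d1 1) x01) ->
  (* zeta_k ~ N(0, I_{d_k}) independent of x, for 2 <= k <= K *)
  (forall k, (2 <= k <= K)%N ->
     std_gaussian_vec P (lvl_dim d1 k) 1 (zeta k) /\
     indep_vec P (coords (lvl_dim d1 K) x) (coords (lvl_dim d1 k) (zeta k))) ->
  let xk := fun k t => level d1 K blk (x t) k in
  let LA := 'E_P[(fun t => sqnorm (lvl_dim d1 K) (fun i => x t i - x0 t i))%R]%E in
  let Lk := fun k : nat =>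
    if k == 1%N then
      'E_P[(fun t => sqnorm (lvl_dim d1 1) (fun i => xk 1%N t i - x01 t i))%R]%E
    else
      'E_P[(fun t => sqnorm (lvl_dim d1 k) (fun i =>
             xk k t i
             - (ups (blk k) (downs (lvl_dim d1 k) (blk k) (xk k t)) i
                + sigma / 2 ^+ k.-1 * zeta k t i)))%R]%E in
  let LB := (\sum_(1 <= k < K.+1) Lk k)%E in
  (LB < LA)%E.
Proof.
move=> K2 d10 s0 part mx ix gx0 ix0 gx01 ix01 gz.
pose xk k t := level d1 K blk (x t) k.
pose LA := ('E_P[(fun t => sqnorm (lvl_dim d1 K) (fun i => x t i - x0 t i))%R])%E.
pose Lk k := (if k == 1%N then
    'E_P[(fun t => sqnorm (lvl_dim d1 1) (fun i => xk 1%N t i - x01 t i))%R]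
  else
    'E_P[(fun t => sqnorm (lvl_dim d1 k) (fun i =>
      xk k t i - (ups (blk k) (downs (lvl_dim d1 k) (blk k) (xk k t)) i
                  + sigma / 2 ^+ k.-1 * zeta k t i)))%R])%E.
pose LB := (\sum_(1 <= k < K.+1) Lk k)%E.
change (LB < LA)%E.
set c := fine (@normal_moment2 R 1).
have c0 : 0 < c.
  rewrite fine_gt0// normal_moment2_gt0/= -ge0_fin_numE.
    exact: normal_moment2_fin_num.
  exact/ltW/normal_moment2_gt0.
have x2 i : (i < lvl_dim d1 K)%N -> x ^~ i \in Lfun P 2%:E.
  by move=> iK; apply: Lfun2P (mx (Ordinal iK)) (ix (Ordinal iK)).
(* Stated for arbitrary [m], [s] and [Z], to serve [x0], [x01] and every [zeta k]. *)
have noise m s Z : 0 < s -> std_gaussian_vec P m s Z ->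
    indep_vec P (coords (lvl_dim d1 K) x) (coords m Z) ->
    forall k i j, (k <= K)%N -> (i < lvl_dim d1 k)%N -> (j < m)%N ->
    [/\ Z ^~ j \in Lfun P 2%:E, L2orth P (Z ^~ j) (fun t => xk k t i) &
      ('E_P[(fun t => Z t j ^+ 2)%R] = (s ^+ 2 * c)%:E)%E].
  move=> s_gt0 gZ indep k i j kK ik jm.
  have [mZ [_ law]] := gZ.
  have [Z2 ZE] := gaussian_moment2 P _ _ s_gt0 (mZ (Ordinal jm)) (law (Ordinal jm)).
  split=> //; apply: L2orth_level => // i' i'K.
  exact: (gaussian_L2orth P _ _ _ _ _ _ _ s_gt0 i'K jm (x2 _ i'K)
    (mx (Ordinal i'K)) gZ indep).
(* Orthogonality to the zero variable is automatic, so propagating it through the levels yields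
   their square-integrability. *)
have zero2 : (fun=> 0) \in Lfun P 2%:E by rewrite (_ : (fun=> 0) = cst 0)// Lfun_cst.
have xk2 k : (k <= K)%N -> L2vec P (lvl_dim d1 k) (xk k).
  move=> kK i ik; apply: (L2orth_level P (fun=> 0) _ _ _ _ _ _ zero2 _ kK ik).1.
  move=> i' i'K; split; first exact: x2.
  rewrite (_ : _ \* _ = cst 0) ?expectation_cst//.
  by apply/funext => t /=; rewrite mulr0.
pose e k := fine 'E_P[(fun t => sqnorm (lvl_dim d1 k) (xk k t))].
have eE k : (k <= K)%N -> ('E_P[(fun t => sqnorm (lvl_dim d1 k) (xk k t))] = (e k)%:E)%E.
  by move=> kK; rewrite fineK// expectation_fin_num// sqnorm_Lfun1//; exact: xk2.
(* This holds for [k > K] as well, where an infinite expectation would be sent to 0 by [fine]. *)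
have e0 k : 0 <= e k.
  by apply/fine_ge0/expectation_ge0 => t; apply: sumr_ge0 => i _; exact: sqr_ge0.
(* The noise energy of the first stage. As d_k = 2^(k-1) d_1, it becomes w / 2^(k-1) at stage k and
   2^(K-1) w in the direct model. *)
pose w := d1%:R * (sigma ^+ 2 * c).
have w0 : 0 < w by rewrite mulr_gt0 ?ltr0n// mulr_gt0// exprn_gt0.
have LAE : LA = (e K + 2 ^+ K.-1 * w)%:E.
  have := expectation_sqnorm_noise P (lvl_dim d1 K) (xk K) x0 1 _
    (fun i iK => noise _ _ _ s0 gx0 ix0 _ _ _ (leqnn K) iK iK).
  under [in X in X -> _]eq_fun => t do under eq_fun => i do rewrite mul1r.
  rewrite eE// /LA /xk /level subnn /= => ->.
  by rewrite -EFinD /w /lvl_dim natrM natrX; congr EFin; ring.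
have L1E : Lk 1%N = (e 1%N + w)%:E.
  have K1 : (1 <= K)%N by exact: leq_trans K2.
  have := expectation_sqnorm_noise P (lvl_dim d1 1) (xk 1%N) x01 1 _
    (fun i i1 => noise _ _ _ s0 gx01 ix01 _ _ _ K1 i1 i1).
  under [in X in X -> _]eq_fun => t do under eq_fun => i do rewrite mul1r.
  rewrite eE// /Lk /= => ->.
  by rewrite -EFinD /w /lvl_dim /= expn0 mul1n; congr EFin; ring.
have LkE k : (2 <= k <= K)%N -> Lk k = (e k - 2 * e k.-1 + w / 2 ^+ k.-1)%:E.
  move=> kK; have /andP[k2 leK] := kK.
  have k1K : (k.-1 <= K)%N by exact: leq_trans (leq_pred k) leK.
  have k0K : (0 < k <= K)%N by rewrite leK (ltn_trans _ k2).
  have [gZ iZ] := gz _ kK.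
  (* Stage k is this projection residual minus scaled noise; the residual is linear in x^(k), hence
     still orthogonal to the noise. *)
  pose f t i := xk k t i - ups (blk k) (downs (lvl_dim d1 k) (blk k) (xk k t)) i.
  have fZ i : (i < lvl_dim d1 k)%N ->
      [/\ (zeta k) ^~ i \in Lfun P 2%:E, L2orth P (zeta k ^~ i) (f ^~ i) &
      ('E_P[(fun t => zeta k t i ^+ 2)%R] = (1 ^+ 2 * c)%:E)%E].
    move=> ik; have H := fun i' ik' => noise _ _ _ ltr01 gZ iZ k i' i leK ik' ik.
    have [Z2 xkZ ZE] := H _ ik; split=> //.
    have DZ : L2orth P (zeta k ^~ i)
        (fun t => downs (lvl_dim d1 k) (blk k) (xk k t) (blk k i)).
      by apply: L2orth_downs => // i' /H[].
    have := L2orth_linear P _ _ _ (-1) Z2 DZ xkZ; congr L2orth.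
    by apply/funext => t; rewrite mulN1r addrC.
  have := expectation_sqnorm_noise P (lvl_dim d1 k) f (zeta k) (sigma / 2 ^+ k.-1) _ fZ.
  rewrite (expectation_sqnorm_sub_ups_downs P _ _ _ _ (part _ kK)).
  - have -> : (fun t => sqnorm (lvl_dim d1 k.-1)
          (downs (lvl_dim d1 k) (blk k) (xk k t))) =
        (fun t => sqnorm (lvl_dim d1 k.-1) (xk k.-1 t)).
      by apply/funext => t; rewrite /xk level_pred.
    rewrite !eE// /Lk gtn_eqF// => LE.
    rewrite (_ : (fun t => _) = fun t => sqnorm (lvl_dim d1 k)
      (fun i => f t i - sigma / 2 ^+ k.-1 * zeta k t i)).
      rewrite LE -EFinM -EFinB -EFinD; congr EFin.
      rewrite /w /lvl_dim natrM natrX; field.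
      by rewrite expf_neq0// pnatr_eq0.
    apply/funext => t; congr sqnorm; apply/funext => i.
    by rewrite /f opprD addrA.
  - exact: xk2.
  - have -> : (fun t => downs (lvl_dim d1 k) (blk k) (xk k t)) = xk k.-1.
      by apply/funext => t; rewrite /xk level_pred.
    exact: xk2.
have LBE : LB = (\sum_(1 <= k < K.+1) fine (Lk k))%:E.
  rewrite -sumEFin; apply: eq_big_nat => k /andP[k1 kK].
  rewrite fineK//; have [k2|] := ltnP 1 k; first by rewrite LkE// k2.
  by rewrite leq_eqVlt ltnS leqNgt k1 orbF => /eqP ->; rewrite L1E.
rewrite LBE LAE lte_fin.
(* The summation lemma is used at n + 1 = K - 1, so that its last stage is K. *)
have [n Kn] : exists n, K = n.+2 by exists (K - 2)%N; rewrite -addn2 subnK.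
have := telescoped_cost_le e (fun k => fine (Lk k)) w n.+1 e0.
rewrite L1E -Kn => /(_ erefl) le_cost; apply: le_lt_trans (le_cost _) _.
  by move=> k kK; rewrite LkE.
have -> : K.-1 = n.+1 by rewrite Kn.
(* The value 2 separates the noise factors: the partial geometric sum is strictly below 2, and
   2^(K-1) is at least 2 because K is at least 2. *)
rewrite ltrD2l [ltRHS]mulrC ltr_pM2l//; apply: (@lt_le_trans _ _ 2).
  by rewrite gtrDl oppr_lt0 divr_gt0// exprn_gt0.
by rewrite exprS ler_peMr// exprn_ege1// ler1n.
Qed.
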